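(* Let $d \geq 2$ be a fixed finite integer and let $\Delta, L > 0$ be given constants independent of $d$. If $0 < \delta < \frac{\Delta}{2L}$ and $0 < \epsilon \leq \frac{L}{252}$, then $$\mathcal{T}_{\delta,\epsilon}(\mathcal{A}_{\det}, \mathcal{F}_{2d}(\Delta, L)) := \inf_{A \in \mathcal{A}_{\det}} \ \sup_{f \in \mathcal{F}_{2d}(\Delta, L)} T_{\delta,\epsilon}(A, f) \ \geq \ d+1 .$$
   Context: All norms are Euclidean. For an integer $n\ge 1$, $\mathcal{F}_n(\Delta, L)$ is the set of functions $f:\mathbb{R}^n \to \mathbb{R}$ that are $L$-Lipschitz ($|f(\mathbf{x})-f(\mathbf{x}')| \le L\|\mathbf{x}-\mathbf{x}'\|$ for all $\mathbf{x},\mathbf{x}'$) and satisfy $f(\mathbf{0}_n) - \inf_{\mathbf{x}\in\mathbb{R}^n} f(\mathbf{x}) \le \Delta$. Clarke subdifferential: $\partial f(\mathbf{x}) = \{\mathbf{g} : \mathbf{g}^\top \mathbf{v} \le Df(\mathbf{x};\mathbf{v}) \text{ for all } \mathbf{v}\}$, where $Df(\mathbf{x};\mathbf{v}) = \limsup_{\mathbf{y}\to\mathbf{x},\, t\downarrow 0} \frac{f(\mathbf{y}+t\mathbf{v})-f(\mathbf{y})}{t}$. For Lipschitz $f$ this is the convex hull of all limits of $\nabla f(\mathbf{x}_k)$ along sequences $\mathbf{x}_k \to \mathbf{x}$ of differentiability points. Goldstein subdifferential: for $\delta>0$, $\partial_\delta f(\mathbf{x}) = \mathrm{conv}\big(\bigcup_{\mathbf{y}: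 \|\mathbf{y}-\mathbf{x}\|\le\delta} \partial f(\mathbf{y})\big)$. Algorithms and oracle: an algorithm accesses $f$ only through a local oracle $\mathbb{O}_f(\mathbf{x}) = (f(\mathbf{x}), \mathbf{g})$, where $\mathbf{g}\in\partial f(\mathbf{x})$ is any Clarke subgradient of $f$ at $\mathbf{x}$ chosen without using global information on $f$ (locality: if $f_1=f_2$ on a ball of some positive radius around $\mathbf{x}$, the oracle's answers at $\mathbf{x}$ for $f_1$ and $f_2$ coincide). $\mathcal{A}_{\det}$ is the class of deterministic algorithms $A$ with access to this oracle: $A$ maps a function $f$ to a sequence of iterates $A[f] = \{\mathbf{x}^t\}_{t\ge 0}$ with $\mathbf{x}^0$ a deterministic point and $\mathbf{x}^t = A^{(t)}(\mathbf{x}^0, \mathbb{O}_f(\mathbf{x}^0), \ldots, \mathbb{O}_f(\mathbf{x}^{t-1}))$ for deterministic maps $A^{(t)}$. Complexity: if $A[f] = \{\mathbf{x}^t\}_{t \ge 0}$, then $T_{\delta,\epsilon}(A,f) = \inf\{t \ge 0 : \min\{\|\mathbf{g}\| : \mathbf{g}\in\partial_\delta f(\mathbf{x}^t)\} < \epsilon\}$ (with $\inf\emptyset=+\infty$). *)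

(* Defs.v *)
From HB Require Import structures.
From mathcomp Require Import all_boot all_order all_algebra.
From mathcomp Require Import all_classical all_reals all_analysis.

Set Implicit Arguments.
Unset Strict Implicit.
Unset Printing Implicit Defensive.

Import Order.TTheory GRing.Theory Num.Theory.
Import numFieldNormedType.Exports.

Local Open Scope classical_set_scope.
Local Open Scope ring_scope.

Definition edot (R : realType) (n : nat) (u v : 'rV[R]_n) : R :=
  \sum_(i < n) u ord0 i * v ord0 i.

(* The library norm on matrices is the max norm, hence this definition. *)
Definition enorm (R : realType) (n : nat) (u : 'rV[R]_n) : R :=
  Num.sqrt (edot u u).

(* The infimum is taken in the extended reals because the real-valued [inf]
   is 0 on sets that are not bounded below. *)
Definition lipschitz_class (R : realType) (n : nat) (Delta L : R) :
    set ('rV[R]_n -> R) :=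
  [set f | (forall x x' : 'rV[R]_n, `|f x - f x'| <= L * enorm (x - x')) /\
    ((f 0)%:E - ereal_inf [set (f x)%:E | x in [set: 'rV[R]_n]]
       <= Delta%:E)%E].

(* The topology of ['rV[R]_n] is the product topology, i.e. the Euclidean
   one. The limsup over (y, t) includes the points with y = x. *)
Definition clarke_dderiv (R : realType) (n : nat) (f : 'rV[R]_n -> R)
    (x v : 'rV[R]_n) : \bar R :=
  limf_esup
    (fun p : 'rV[R]_n * R => ((f (p.1 + p.2 *: v) - f p.1) / p.2)%:E)
    (filter_prod (nbhs x) (0 : R)^'+).

Definition clarke_subdiff (R : realType) (n : nat) (f : 'rV[R]_n -> R)
    (x : 'rV[R]_n) : set 'rV[R]_n :=
  [set g | forall v, ((edot g v)%:E <= clarke_dderiv f x v)%E].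

Definition convex_hull (R : realType) (n : nat) (S : set 'rV[R]_n) :
    set 'rV[R]_n :=
  smallest [set C : set 'rV[R]_n |
    convex_set (C : set (convex_lmodType 'rV[R]_n))] S.

Definition goldstein_subdiff (R : realType) (n : nat) (delta : R)
    (f : 'rV[R]_n -> R) (x : 'rV[R]_n) : set 'rV[R]_n :=
  convex_hull
    (\bigcup_(y in [set y | enorm (y - x) <= delta]) clarke_subdiff f y).

(* Oracles are total functions, but are constrained only on the function
   class [F]. *)
Definition local_oracle (R : realType) (n : nat) (F : set ('rV[R]_n -> R))
    (O : ('rV[R]_n -> R) -> 'rV[R]_n -> R * 'rV[R]_n) : Prop :=
  [/\ forall f x, F f -> (O f x).1 = f x,
      forall f x, F f -> clarke_subdiff f x (O f x).2
    & forall f1 f2 x, F f1 -> F f2 ->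
        (exists2 r : R, 0 < r &
           forall y, enorm (y - x) < r -> f1 y = f2 y) ->
        O f1 x = O f2 x].

(* An algorithm is identified with the map sending f to its iterates. *)
Definition det_algorithms (R : realType) (n : nat) (F : set ('rV[R]_n -> R))
    (O : ('rV[R]_n -> R) -> 'rV[R]_n -> R * 'rV[R]_n) :
    set (('rV[R]_n -> R) -> nat -> 'rV[R]_n) :=
  [set A | exists (x0 : 'rV[R]_n)
    (step : forall t : nat, 'rV[R]_n -> t.-tuple (R * 'rV[R]_n) -> 'rV[R]_n),
    forall f, F f ->
      A f 0%N = x0 /\
      forall t : nat, (0 < t)%N ->
        A f t = step t x0 [tuple O f (A f i) | i < t]].

(* For Lipschitz f the Goldstein subdifferential is nonempty and compact, so
   the infimum of the norms is their minimum. *)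
Definition goldstein_min_norm (R : realType) (n : nat) (delta : R)
    (f : 'rV[R]_n -> R) (x : 'rV[R]_n) : \bar R :=
  ereal_inf [set (enorm g)%:E | g in goldstein_subdiff delta f x].

Definition hitting_time (R : realType) (n : nat) (delta eps : R)
    (A : ('rV[R]_n -> R) -> nat -> 'rV[R]_n) (f : 'rV[R]_n -> R) : \bar R :=
  ereal_inf [set t%:R%:E | t in
    [set t : nat | (goldstein_min_norm delta f (A f t) < eps%:E)%E]].

Definition class_complexity (R : realType) (n : nat) (delta eps : R)
    (Alg : set (('rV[R]_n -> R) -> nat -> 'rV[R]_n))
    (F : set ('rV[R]_n -> R)) : \bar R :=
  ereal_inf [set ereal_sup [set hitting_time delta eps A f | f in F]
    | A in Alg].

(* Main.v *)
(* Fix a unit vector e and answer every query with the value 0 and the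
   subgradient c e.  The iterates x_0, ..., x_d are then determined, and since
   d + 1 < 2 d there is a unit vector w orthogonal to e and to all the
   differences x_i - x_0.  The ramp W(x) = c <w, x - x_0> vanishes at every
   iterate.  Inside tiny disjoint balls around the iterates, clamp
   E_i(x) = c <e, x - x_i> between W - b_i and W + b_i, where b_i is a small
   cone of slope c / 2 centred at x_i: the result equals E_i near x_i, so it is
   consistent with the answers, and equals W away from the iterates.  All
   pieces E_i, W, W - b_i, W + b_i increase at rate at least c / 4 along e + w,
   because |e + w| = sqrt 2 <= 3 / 2, and so do their minima and maxima.
   Truncating at a level -M that is not reached within distance delta of the
   iterates makes the function bounded below, and all its Clarke gradients g
   in these balls satisfy <g, e + w> >= c / 4, hence so do the Goldstein ones.
   With c = 2 L / 3 the function is L-Lipschitz and the norms are at least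
   L / 9. *)
Require Import Defs.
From HB Require Import structures.
From mathcomp Require Import all_boot all_order all_algebra.
From mathcomp Require Import all_classical all_reals all_analysis.
From mathcomp Require Import ring lra.

Set Implicit Arguments.
Unset Strict Implicit.
Unset Printing Implicit Defensive.

Import Order.TTheory GRing.Theory Num.Theory.
Import numFieldNormedType.Exports.

Local Open Scope classical_set_scope.
Local Open Scope ring_scope.

(** * Euclidean norm and Clarke directional derivatives *)

Section Euclidean.
Context {R : realType} {n : nat}.
Implicit Types u v w x : 'rV[R]_n.

Lemma edotC u v : edot u v = edot v u.
Proof. by apply: eq_bigr => i _; rewrite mulrC. Qed.

Lemma edotDr u v w : edot u (v + w) = edot u v + edot u w.
Proof. by rewrite -big_split; apply: eq_bigr => i _; rewrite mxE mulrDr. Qed.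

Lemma edotZr u v (a : R) : edot u (a *: v) = a * edot u v.
Proof. by rewrite mulr_sumr; apply: eq_bigr => i _; rewrite mxE mulrCA. Qed.

Lemma edotNr u v : edot u (- v) = - edot u v.
Proof. by rewrite -scaleN1r edotZr mulN1r. Qed.

Lemma edotBr u v w : edot u (v - w) = edot u v - edot u w.
Proof. by rewrite edotDr edotNr. Qed.

Lemma edotDl u v w : edot (u + v) w = edot u w + edot v w.
Proof. by rewrite edotC edotDr !(edotC w). Qed.

Lemma edotZl u v (a : R) : edot (a *: u) v = a * edot u v.
Proof. by rewrite edotC edotZr edotC. Qed.

Lemma edotBl u v w : edot (u - v) w = edot u w - edot v w.
Proof. by rewrite edotC edotBr !(edotC w). Qed.

Lemma edot_ge0 u : 0 <= edot u u.
Proof. by apply: sumr_ge0 => i _; rewrite -expr2 sqr_ge0. Qed.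

Lemma edot_eq0 u : (edot u u == 0) = (u == 0).
Proof.
apply/eqP/eqP => [/eqP|->]; last first.
  by rewrite /edot big1 // => i _; rewrite mxE mul0r.
rewrite psumr_eq0 => [/allP u0|i _]; last by rewrite -expr2 sqr_ge0.
apply/rowP => i; rewrite mxE; apply/eqP.
by have := u0 i (mem_index_enum i); rewrite -expr2 sqrf_eq0.
Qed.

Lemma enorm_ge0 u : 0 <= enorm u.
Proof. exact: sqrtr_ge0. Qed.

Lemma enorm_sqr u : enorm u ^+ 2 = edot u u.
Proof. by rewrite sqr_sqrtr // edot_ge0. Qed.

Lemma enorm_eq0 u : (enorm u == 0) = (u == 0).
Proof. by rewrite -edot_eq0 -enorm_sqr sqrf_eq0. Qed.

Lemma enorm0 : enorm (0 : 'rV[R]_n) = 0.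
Proof. by apply/eqP; rewrite enorm_eq0. Qed.

Lemma enorm_gt0 u : (0 < enorm u) = (u != 0).
Proof. by rewrite lt_def enorm_ge0 andbT enorm_eq0. Qed.

Lemma enormZ (a : R) u : enorm (a *: u) = `|a| * enorm u.
Proof.
by rewrite /enorm edotZl edotZr mulrA -expr2 sqrtrM ?sqr_ge0// sqrtr_sqr.
Qed.

Lemma enormN u : enorm (- u) = enorm u.
Proof. by rewrite -scaleN1r enormZ normrN1 mul1r. Qed.

Lemma enormC u v : enorm (u - v) = enorm (v - u).
Proof. by rewrite -enormN opprB. Qed.

Lemma edot_le u v : edot u v <= enorm u * enorm v.
Proof.
have [->|u0] := eqVneq u 0.
  by rewrite enorm0 mul0r -(scale0r 0) edotZl mul0r.
have [->|v0] := eqVneq v 0.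
  by rewrite enorm0 mulr0 -(scale0r 0) edotZr mul0r.
(* Expanding this square gives [2 * (p * q) * (p * q - z)], with [p], [q] the norms and [z] the
   product. *)
have := edot_ge0 (enorm v *: u - enorm u *: v).
rewrite !(edotBl, edotBr, edotZl, edotZr) -!enorm_sqr (edotC v u).
move: u0 v0; rewrite -!enorm_gt0.
move: (enorm u) (enorm v) (edot u v) => p q z p0 q0 h.
have : 0 <= (p * q) * (p * q - z) by nra.
by rewrite pmulr_rge0 ?mulr_gt0// subr_ge0.
Qed.

Lemma ler_enormD u v : enorm (u + v) <= enorm u + enorm v.
Proof.
have h : 0 <= enorm u + enorm v by rewrite addr_ge0 ?enorm_ge0.
rewrite -(ler_pXn2r (n := 2)) ?nnegrE ?enorm_ge0//.
rewrite enorm_sqr !(edotDl, edotDr) -!enorm_sqr (edotC v u).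
by have := edot_le u v; nra.
Qed.

Lemma ler_enormB u v w : enorm (u - w) <= enorm (u - v) + enorm (v - w).
Proof. by rewrite (_ : u - w = (u - v) + (v - w)) ?ler_enormD// addrA subrK. Qed.

Lemma edot_ge u v : - (enorm u * enorm v) <= edot u v.
Proof. by rewrite lerNl -edotNr -(enormN v) edot_le. Qed.

Lemma nbhs_enorm x (eta : R) : 0 < eta -> nbhs x [set y | enorm (y - x) < eta].
Proof.
(* The neighbourhoods are max-norm balls; [n.+1] makes [n%:R * a < eta] strict and covers
   [n = 0]. *)
move=> eta0; pose a := eta / n.+1%:R.
have a0 : 0 < a by rewrite divr_gt0.
apply/nbhs_ballP; exists a => //= y [_ xy].
apply: (@le_lt_trans _ _ (n%:R * a)); last first.
  by rewrite mulrCA gtr_pMr// ltr_pdivrMr// mul1r ltr_nat.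
have na0 : 0 <= n%:R * a by rewrite mulr_ge0// ltW.
rewrite -(ger0_norm na0) -sqrtr_sqr ler_wsqrtr//.
rewrite exprMn; apply: (@le_trans _ _ (\sum_(i < n) a ^+ 2)).
  apply: ler_sum => i _; rewrite -expr2 -real_normK ?num_real//.
  rewrite ler_pXn2r ?nnegrE ?normr_ge0 ?(ltW a0)// ltW//.
  by have := xy ord0 i; rewrite /= !mxE distrC.
rewrite sumr_const card_ord -[leLHS]mulr_natl ler_wpM2r ?sqr_ge0//.
by rewrite -natrX ler_nat; case: (n) => // k; rewrite expnS leq_pmulr ?expn1.
Qed.

(** The limsup is an infimum over neighbourhoods, so a bound on one of them suffices. *)
Lemma clarke_dderiv_le (f : 'rV[R]_n -> R) x v (K eta : R) : 0 < eta ->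
  (forall y t, 0 < t < eta -> enorm (y - x) < eta ->
     f (y + t *: v) - f y <= K * t) ->
  (clarke_dderiv f x v <= K%:E)%E.
Proof.
move=> eta0 fK; rewrite /clarke_dderiv /limf_esup.
pose V := [set y | enorm (y - x) < eta] `*` [set t : R | 0 < t < eta].
set S := (S in ereal_inf S); pose q := fun p : 'rV[R]_n * R =>
  ((f (p.1 + p.2 *: v) - f p.1) / p.2)%:E.
have VS : S (ereal_sup (q @` V)).
  exists V => //; exists ([set y | enorm (y - x) < eta], [set t | 0 < t < eta]).
    split; first exact: nbhs_enorm.
    near=> t; apply/andP; split; near: t.
      exact: nbhs_right_gt.
    exact: nbhs_right_lt.
  by [].
apply: le_trans (ereal_inf_lbound VS) _.
apply: ge_ereal_sup => _ [[y t] [/= yx /andP[t0 t1]] <-].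
by rewrite /q /= lee_fin ler_pdivrMr// fK// t0.
Unshelve. all: by end_near.
Qed.

(* The half-space of vectors [h] with [K <= edot h v] is convex, so it contains
   the Goldstein subdifferential as soon as it contains the Clarke ones. *)
Lemma goldstein_min_norm_ge (f : 'rV[R]_n -> R) x v (delta K : R) :
  0 <= K ->
  (forall y, enorm (y - x) <= delta ->
     (clarke_dderiv f y (- v) <= (- K)%:E)%E) ->
  ((K / enorm v)%:E <= goldstein_min_norm delta f x)%E.
Proof.
move=> K0 fK; apply: le_ereal_inf_tmp => _ [g gS <-].
have Kg : K <= edot g v.
  apply: (gS [set h | K <= edot h v]); split.
    move=> a b l /[!inE] /= ha hb.
    rewrite /conv/= edotDl !edotZl /unstable.onem.
    have l0 : 0 <= l%:num by [].
    have l1 : l%:num <= 1 by [].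
    by nra.
  move=> h [y /= yx /(_ (- v))]; rewrite edotNr => hy.
  by have := le_trans hy (fK y yx); rewrite lee_fin lerN2.
rewrite lee_fin; have [->|v0] := eqVneq v 0.
  by rewrite enorm0 invr0 mulr0 enorm_ge0.
by rewrite ler_pdivrMr ?enorm_gt0// (le_trans Kg)// edot_le.
Qed.

(** A subgradient [g] satisfies [edot g v <= edot a v] for all [v]; taking [v = g - a] forces
    [g = a]. This leaves the oracle no choice of answer. *)
Lemma clarke_subdiff_linear (f : 'rV[R]_n -> R) x a (s : R) : 0 < s ->
  (forall y, enorm (y - x) < s -> f y = edot a (y - x)) ->
  clarke_subdiff f x `<=` [set a].
Proof.
move=> s0 fa g gS /=.
have gv v : edot g v <= edot a v.
  rewrite -lee_fin; apply: le_trans (gS v) _.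
  have e0 : 0 < 1 + enorm v by rewrite ltr_pwDl// enorm_ge0.
  apply: (@clarke_dderiv_le _ _ _ _ (s / 2 / (1 + enorm v))).
    by rewrite !divr_gt0.
  move=> y t /andP[t0 ts] yx.
  have yx2 : enorm (y - x) < s / 2.
    apply: lt_le_trans yx _; rewrite ler_pdivrMr//.
    by have := enorm_ge0 v; nra.
  have tv : enorm (t *: v) < s / 2.
    rewrite enormZ gtr0_norm//; move: ts; rewrite ltr_pdivlMr//.
    by have := enorm_ge0 v; nra.
  rewrite !fa; first by rewrite !(edotBr, edotDr) edotZr; lra.
    by rewrite (lt_trans yx2)//; lra.
  rewrite addrAC (le_lt_trans (ler_enormD _ _))//; lra.
apply/eqP; rewrite -subr_eq0 -edot_eq0 eq_le edot_ge0 andbT.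
by rewrite {1}edotBl subr_le0 gv.
Qed.

End Euclidean.

(** * Orthogonal directions and separated balls *)

Lemma orthogonal_unit (R : realType) (k n : nat) (X : 'I_k -> 'rV[R]_n) :
  (k < n)%N -> exists2 w, edot w w = 1 & forall i, edot w (X i) = 0.
Proof.
move=> kn; pose A := \matrix_(i < n, j < k) X j ord0 i.
(* The matrix with columns [X j] has rank at most [k < n], so its left kernel is nonzero. *)
have /rowV0Pn[w /sub_kermxP wA w0] : kermx A != 0.
  by rewrite kermx_eq0 /row_free ltn_eqF// (leq_ltn_trans (rank_leq_col A)).
have wX j : edot w (X j) = 0.
  transitivity ((w *m A) ord0 j); last by rewrite wA mxE.
  by rewrite mxE; apply: eq_bigr => i _; rewrite mxE.
exists ((enorm w)^-1 *: w) => [|i]; last by rewrite edotZl wX mulr0.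
by rewrite edotZl edotZr -enorm_sqr expr2 mulKf ?mulVf ?enorm_eq0.
Qed.

(** Iterates may repeat, so only distinct points are separated: half their least distance, capped by
    [r0], works. *)
Lemma separation_radius (R : realType) (m n : nat) (X : 'I_m -> 'rV[R]_n)
    (r0 : R) : 0 < r0 ->
  exists r, [/\ 0 < r, r <= r0 &
    forall i j, X i = X j \/ 2 * r <= enorm (X i - X j)].
Proof.
move=> r00; exists (\big[Num.min/r0]_(p : 'I_m * 'I_m | X p.1 != X p.2)
  (enorm (X p.1 - X p.2) / 2)); split.
- by apply: lt_bigmin => // p Xp; rewrite divr_gt0// enorm_gt0 subr_eq0.
- exact: bigmin_le_id.
- move=> i j; have [->|Xij] := eqVneq (X i) (X j); [by left|right].
  rewrite mulrC -ler_pdivlMr//.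
  exact: (@bigmin_le_cond _ _ _ _ (i, j)
    (fun p : 'I_m * 'I_m => X p.1 != X p.2)
    (fun p => enorm (X p.1 - X p.2) / 2)).
Qed.

(** * Finite minima and maxima under perturbation *)

Section BigShift.
Context {R : realType} {I : finType}.
Implicit Types (F G : I -> R) (a b k : R).

Lemma bigmax_shift F G a b k : b <= a + k -> (forall i, G i <= F i + k) ->
  \big[Num.max/b]_i G i <= \big[Num.max/a]_i F i + k.
Proof.
move=> ab FG; apply/bigmax_leP; split=> [|i _].
  by apply: le_trans ab _; rewrite lerD2r bigmax_ge_id.
by apply: le_trans (FG i) _; rewrite lerD2r (le_bigmax_cond _ _ (j := i)).
Qed.

Lemma bigmin_shift F G a b k : b <= a + k -> (forall i, G i <= F i + k) ->
  \big[Num.min/b]_i G i <= \big[Num.min/a]_i F i + k.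
Proof.
move=> ab FG; rewrite -lerBlDr; apply/bigmin_geP; split=> [|i _].
  by rewrite lerBlDr; apply: le_trans ab; exact: bigmin_le_id.
by rewrite lerBlDr; apply: le_trans (FG i); exact: bigmin_le.
Qed.

End BigShift.

(** * The resisting function and its estimates *)

Section ResistingFunction.
Context {R : realType} {m n : nat}.
Variables (X : 'I_m.+1 -> 'rV[R]_n) (e w : 'rV[R]_n) (c r M : R).

Definition ramp x := c * edot w (x - X ord0).

Definition tilt i x := c * edot e (x - X i).

(** Not truncated at 0: away from the centres it is negative, and the default values of the two big
    operators below take over. *)
Definition bump i x := c / 2 * (r - enorm (x - X i)).

Definition lower_envelope x :=
  \big[Num.min/ramp x]_i (ramp x - bump i x).

Definition tilted_ramp x :=
  \big[Num.max/lower_envelope x]_i Num.min (tilt i x) (ramp x + bump i x).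

Definition resisting x := Num.max (- M) (tilted_ramp x).

Hypotheses (c0 : 0 < c) (r0 : 0 < r).
Hypotheses (e1 : edot e e = 1) (w1 : edot w w = 1) (we : edot w e = 0).
Hypothesis wX : forall i, edot w (X i) = edot w (X ord0).
Hypothesis sepX : forall i j, X i = X j \/ 2 * r <= enorm (X i - X j).

Let enorm_e : enorm e = 1.
Proof. by rewrite /enorm e1 sqrtr1. Qed.

Let enorm_w : enorm w = 1.
Proof. by rewrite /enorm w1 sqrtr1. Qed.

Let ew : edot e w = 0.
Proof. by rewrite edotC. Qed.

Lemma rampE i x : ramp x = c * edot w (x - X i).
Proof. by rewrite /ramp !edotBr wX. Qed.

(* Every piece of [tilted_ramp] satisfies this one-sided bound, and minima and
   maxima preserve it; it gives both the Lipschitz constant and the rate of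
   increase along [e + w]. *)
Lemma tilted_ramp_shift x y k :
  c * edot e (y - x) <= k ->
  c * edot w (y - x) + c / 2 * enorm (y - x) <= k ->
  tilted_ramp y <= tilted_ramp x + k.
Proof.
move=> ek wk.
have tiltk i : tilt i y <= tilt i x + k.
  by move: ek; rewrite /tilt !edotBr; lra.
have rampk s : `|s| <= enorm (y - x) -> ramp y + c / 2 * s <= ramp x + k.
  rewrite ler_norml => /andP[_ sxy].
  have : c / 2 * s <= c / 2 * enorm (y - x) by rewrite ler_pM2l// divr_gt0.
  by move: wk; rewrite /ramp !edotBr; lra.
have bumpk i : `|enorm (x - X i) - enorm (y - X i)| <= enorm (y - x).
  rewrite ler_norml; have := ler_enormB x y (X i).
  have := ler_enormB y x (X i); rewrite (enormC x y); lra.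
apply: bigmax_shift => [|i].
  apply: bigmin_shift => [|i].
    by have := rampk 0; rewrite normr0 mulr0 addr0 enorm_ge0; apply.
  have := rampk (enorm (y - X i) - enorm (x - X i)).
  by rewrite distrC bumpk /bump => /(_ isT); lra.
rewrite -lerBlDr le_min !lerBlDr; apply/andP; split.
  by rewrite ge_min tiltk.
rewrite ge_min; apply/orP; right.
have := rampk (enorm (x - X i) - enorm (y - X i)).
by rewrite bumpk /bump => /(_ isT); lra.
Qed.

Lemma resisting_lipschitz x y :
  `|resisting x - resisting y| <= 3 / 2 * c * enorm (x - y).
Proof.
have lip u v : tilted_ramp v <= tilted_ramp u + 3 / 2 * c * enorm (u - v).
  have ch : 0 <= c * enorm (v - u) by rewrite mulr_ge0 ?enorm_ge0// ltW.
  rewrite enormC; apply: tilted_ramp_shift.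
    have := edot_le e (v - u); rewrite enorm_e mul1r -(ler_pM2l c0).
    by lra.
  have := edot_le w (v - u); rewrite enorm_w mul1r -(ler_pM2l c0).
  by lra.
have lipM u v : resisting v <= resisting u + 3 / 2 * c * enorm (u - v).
  rewrite /resisting ge_max; apply/andP; split.
    rewrite (@le_trans _ _ (Num.max (- M) (tilted_ramp u)))//.
      by rewrite le_max lexx.
    by rewrite lerDl !mulr_ge0 ?enorm_ge0// ltW.
  by apply: le_trans (lip u v) _; rewrite lerD2r le_max lexx orbT.
rewrite ler_norml; have := lipM x y; have := lipM y x.
by rewrite (enormC y x); lra.
Qed.

Lemma tilted_ramp_ge x : ramp x - c / 2 * r <= tilted_ramp x.
Proof.
apply: le_trans (bigmax_ge_id _ _ _ _).
apply: le_bigmin => [|i _]; first by rewrite gerBl mulr_ge0// ltW// divr_gt0.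
by rewrite lerD2l lerN2 ler_pM2l ?divr_gt0// gerBl enorm_ge0.
Qed.

Lemma tilted_ramp_le x : tilted_ramp x <= ramp x + c / 2 * r.
Proof.
apply/bigmax_leP; split=> [|i _].
  apply: le_trans (bigmin_le_id _ _ _ _) _.
  by rewrite lerDl mulr_ge0// ltW// divr_gt0.
by rewrite ge_min lerD2l ler_pM2l ?divr_gt0// gerBl enorm_ge0 orbT.
Qed.

(** Put [u = enorm (x - X j)]; ramp and tilt lie between [- c u] and [c u]. The clamp at [j] is
    inactive if [2 u <= (r - u) / 2], and the term of another centre stays below [tilt j x] if
    [3 u / 2 - r / 2 <= - u]; both say [u <= r / 5]. *)
Lemma tilted_ramp_near j x :
  enorm (x - X j) < r / 5 -> tilted_ramp x = tilt j x.
Proof.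
move=> xr; have u0 := enorm_ge0 (x - X j).
have cu : c * enorm (x - X j) < c * (r / 5) by rewrite ltr_pM2l.
have Wle : ramp x <= c * enorm (x - X j).
  by rewrite (rampE j) ler_pM2l// -[leRHS]mul1r -enorm_w edot_le.
have Wge : - (c * enorm (x - X j)) <= ramp x.
  rewrite (rampE j) -mulrN ler_pM2l//.
  by have := edot_ge w (x - X j); rewrite enorm_w mul1r.
have Ele : tilt j x <= c * enorm (x - X j).
  by rewrite /tilt ler_pM2l// -[leRHS]mul1r -enorm_e edot_le.
have Ege : - (c * enorm (x - X j)) <= tilt j x.
  rewrite /tilt -mulrN ler_pM2l//.
  by have := edot_ge e (x - X j); rewrite enorm_e mul1r.
apply/eqP; rewrite eq_le; apply/andP; split; last first.
  apply: le_trans (le_bigmax_cond _ _ (j := j) _) => //.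
  by rewrite le_min lexx /bump /=; lra.
apply/bigmax_leP; split=> [|i _].
  by apply: le_trans (bigmin_le _ j _) _; rewrite /bump; lra.
have [Xij|Xij] := sepX i j; first by rewrite ge_min /tilt Xij lexx.
rewrite ge_min; apply/orP; right; rewrite /bump.
have := ler_enormB (X i) x (X j); rewrite (enormC (X i) x) => tri.
have : c / 2 * (2 * r - enorm (x - X j)) <= c / 2 * enorm (x - X i).
  by rewrite ler_pM2l ?divr_gt0//; lra.
lra.
Qed.

Lemma resisting_near j x : c * (r / 5) <= M ->
  enorm (x - X j) < r / 5 -> resisting x = edot (c *: e) (x - X j).
Proof.
move=> crM xr; rewrite /resisting (tilted_ramp_near xr) edotZl; apply: max_r.
apply: (@le_trans _ _ (c * - enorm (x - X j))); last first.
  rewrite ler_pM2l//.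
  by have := edot_ge e (x - X j); rewrite enorm_e mul1r.
by rewrite mulrN lerN2 (le_trans _ crM)// ler_pM2l// ltW.
Qed.

Lemma enorm_direction : 0 < enorm (e + w) <= 3 / 2.
Proof.
have s : enorm (e + w) ^+ 2 = 2.
  by rewrite enorm_sqr !(edotDl, edotDr) e1 w1 we ew; lra.
have := enorm_ge0 (e + w); rewrite le_eqVlt => /predU1P[z|->]/=.
  by move: s; rewrite -z expr0n/=; lra.
by move: s; have := enorm_ge0 (e + w); nra.
Qed.

Lemma resisting_clarke_dderiv j y :
  c * (enorm (y - X j) + r / 2) < M ->
  (clarke_dderiv resisting y (- (e + w)) <= (- (c / 4))%:E)%E.
Proof.
(* Half of the slack below [M] absorbs the distance from [p] to [y], half the step [t], so
   truncation is inactive at [q]. *)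
move=> yM; pose eta := (M - c * (enorm (y - X j) + r / 2)) / (2 * c).
have eta0 : 0 < eta by rewrite divr_gt0 ?subr_gt0// mulr_gt0.
have ceta : c * (enorm (y - X j) + r / 2 + 2 * eta) = M.
  by rewrite /eta; field; rewrite gt_eqF.
apply: (clarke_dderiv_le eta0) => p t /andP[t0 teta] py.
set q := p + _.
have qp : q - p = - (t *: (e + w)) by rewrite /q addrC addKr scalerN.
have qM : - M <= tilted_ramp q.
  apply: le_trans (tilted_ramp_ge q).
  have := edot_ge w (p - X j); rewrite enorm_w mul1r.
  have := ler_enormB p y (X j).
  move=> pj wp; rewrite (rampE j) -(subrK p q) qp -addrA.
  rewrite [edot w (_ + _)]edotDr edotNr edotZr edotDr we w1 -ceta add0r mulr1.
  have : c * - (enorm (y - X j) + 2 * eta) <= c * (- t + edot w (p - X j)).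
    by rewrite ler_pM2l//; lra.
  lra.
rewrite /resisting (max_r qM) lerBlDl.
apply: (@le_trans _ _ (tilted_ramp p + - (c / 4) * t)); last first.
  by rewrite lerD2r le_max lexx orbT.
have /andP[_ vle] := enorm_direction.
have ct : 0 < c * t by rewrite mulr_gt0.
apply: tilted_ramp_shift; rewrite qp ?enormN edotNr edotZr edotDr.
  by rewrite e1 ew; nra.
rewrite we w1 enormZ gtr0_norm//.
(* The ramp loses [c * t] and the cone gives back at most [3 / 4 * (c * t)]. *)
have : c * t * enorm (e + w) <= c * t * (3 / 2) by rewrite ler_pM2l.
lra.
Qed.

Lemma resisting_goldstein_min_norm_ge j delta :
  c * (delta + r / 2) < M ->
  ((c / 6)%:E <= goldstein_min_norm delta resisting (X j))%E.
Proof.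
move=> dM; have /andP[v0 vle] := enorm_direction.
apply: (@le_trans _ _ (c / 4 / enorm (e + w))%:E).
  have : c * enorm (e + w) <= c * (3 / 2) by rewrite ler_pM2l.
  by rewrite lee_fin ler_pdivlMr//; lra.
apply: goldstein_min_norm_ge => [|y yd]; first by rewrite divr_ge0// ltW.
apply: (@resisting_clarke_dderiv j); apply: le_lt_trans dM.
by rewrite ler_pM2l// lerD2r.
Qed.

(** The sign condition gives [ramp 0 <= 0], so the value at 0 is at most [c * (r / 2)], while the
    truncation keeps the infimum above [- M]. *)
Lemma resisting_lipschitz_class Delta : 0 <= edot w (X ord0) ->
  c * (r / 2) + M <= Delta -> 0 <= M ->
  lipschitz_class Delta (3 / 2 * c) resisting.
Proof.
move=> wx0 cM M0; split; first exact: resisting_lipschitz.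
have infM : ((- M)%:E <=
    ereal_inf [set (resisting x)%:E | x in [set: 'rV[R]_n]])%E.
  by apply: le_ereal_inf_tmp => _ [x _ <-]; rewrite lee_fin le_max lexx.
apply: le_trans (leeB (lexx _) infM) _.
rewrite -EFinB lee_fin opprK -lerBrDr ge_max; apply/andP; split.
  have : 0 < c * r by rewrite mulr_gt0.
  lra.
apply: le_trans (tilted_ramp_le 0) _.
rewrite /ramp sub0r edotNr mulrN.
have := mulr_ge0 (ltW c0) wx0; lra.
Qed.

End ResistingFunction.

(** * The resisting-oracle argument *)

Theorem theorem4p2 (R : realType) (d : nat) (hd : (2 <= d)%N)
    (Delta L : R) (hDelta : 0 < Delta) (hL : 0 < L)
    (delta eps : R)
    (hdelta0 : 0 < delta) (hdelta : delta < Delta / (2 * L))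
    (heps0 : 0 < eps) (heps : eps <= L / 252)
    (O : ('rV[R]_(2 * d) -> R) -> 'rV[R]_(2 * d) -> R * 'rV[R]_(2 * d))
    (hO : local_oracle (@lipschitz_class R (2 * d) Delta L) O) :
  (((d.+1)%:R : R)%:E <=
    class_complexity delta eps
      (det_algorithms (@lipschitz_class R (2 * d) Delta L) O)
      (@lipschitz_class R (2 * d) Delta L))%E.
Proof.
apply: le_ereal_inf_tmp => _ [A [x0 [step hA]] <-].
have [e e1 _] : exists2 e : 'rV[R]_(2 * d), edot e e = 1 &
    forall i : 'I_0, edot e ((fun=> 0) i) = 0.
  by apply: orthogonal_unit; rewrite muln_gt0 (ltn_trans _ hd).
(* Here [3 / 2 * c = L]. The later bound [L * r <= 3 / 10 * Delta] gives
   [c * (r / 2) <= Delta / 10], which leaves [9 / 10 * Delta] for [M]. *)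
pose c := 2 / 3 * L; pose M := 9 / 10 * Delta.
have c0 : 0 < c by rewrite mulr_gt0.
(* The trajectory under the constant answer [(0, c *: e)], fixed before [f] is built from it. *)
pose xs t := if t is 0 then x0 else step t x0 [tuple (0, c *: e) | i < t].
pose X (i : 'I_d.+1) := xs i.
have [w [w1 we wX wx0]] : exists w, [/\ edot w w = 1, edot w e = 0,
    forall i, edot w (X i) = edot w (X ord0) & 0 <= edot w (X ord0)].
  (* Slot [ord0], where the difference vanishes, holds [e]; the [d.+1] constraints are fewer than
     [2 * d] because [2 <= d]. *)
  have [|w w1 wY] := @orthogonal_unit R d.+1 (2 * d)
    (fun i => if i == ord0 then e else X i - X ord0).
    by rewrite mul2n -addnn -addn1 ltn_add2l.
  have we : edot w e = 0 by have := wY ord0; rewrite eqxx.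
  have wX i : edot w (X i) = edot w (X ord0).
    have [->//|i0] := eqVneq i ord0.
    by apply/eqP; rewrite -subr_eq0 -edotBr; have := wY i; rewrite (negPf i0) => ->.
  (* Passing to [- w] if needed makes the ramp nonpositive at the origin. *)
  have [wx0|wx0] := leP 0 (edot w (X ord0)); first by exists w.
  exists (- w); split.
  - by rewrite edotNr edotC edotNr opprK.
  - by rewrite edotC edotNr edotC we oppr0.
  - by move=> i; rewrite edotC edotNr edotC wX [RHS]edotC edotNr [in RHS]edotC.
  - by rewrite edotC edotNr edotC oppr_ge0 ltW.
have [|r [r0 rle sepX]] := @separation_radius R _ _ X (3 / 10 * Delta / L).
  by rewrite divr_gt0// mulr_gt0.
have rL : L * r <= 3 / 10 * Delta by rewrite mulrC -ler_pdivlMr.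
have dL : L * delta < Delta / 2.
  by move: hdelta; rewrite ltr_pdivlMr ?mulr_gt0//; lra.
pose f := resisting X e w c r M.
have Ff : lipschitz_class Delta L f.
  have -> : L = 3 / 2 * c by rewrite /c; lra.
  by apply: resisting_lipschitz_class => //; rewrite /M /c; lra.
have crM : c * (r / 5) <= M by rewrite /c /M; lra.
have OX j : O f (X j) = (0, c *: e).
  have near y : enorm (y - X j) < r / 5 -> f y = edot (c *: e) (y - X j).
    exact: resisting_near.
  have r5 : 0 < r / 5 by rewrite divr_gt0.
  case: hO => Of Og _; rewrite [LHS]surjective_pairing Of//; congr pair.
    by rewrite near subrr ?enorm0// -(scale0r 0) edotZr mul0r.
  exact: clarke_subdiff_linear r5 near _ (Og f (X j) Ff).
(* By strong induction the true answers for [f] are the constant ones, so both trajectories agree up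
   to [d]. *)
have AX t : (t <= d)%N -> A f t = xs t.
  elim/ltn_ind: t => -[|t] IH td; first by have [] := hA f Ff.
  have [_ ->//] := hA f Ff; congr step; apply: eq_from_tnth => i.
  have id : (i < d.+1)%N by rewrite ltnS (leq_trans (ltnW (ltn_ord i))).
  by rewrite !tnth_mktuple IH// -(OX (Ordinal id)).
apply: le_trans (ereal_sup_ubound (imageP _ Ff)).
apply: le_ereal_inf_tmp => _ [t /= teps <-].
rewrite lee_fin ler_nat ltnNge; apply/negP => td.
move: teps; rewrite AX// ltNge => /negP; apply.
have td1 : (t < d.+1)%N by [].
apply: le_trans (@resisting_goldstein_min_norm_ge _ _ _ X e w c r M
  c0 r0 e1 w1 we wX (Ordinal td1) delta _).
  by rewrite lee_fin /c; lra.
by rewrite /c /M; lra.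
Qed.
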